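(* Let $d\ge 2$, $n\in\mathbb N$, and let $\Gamma=(\Gamma_1,\dots,\Gamma_d)$ with $\Gamma_k\subseteq\{1,\dots,n\}\times\{1,\dots,n\}$, and assume $\Gamma_1$ is symmetric. Then for all $p,r\in\mathbb{N}$ and $q\in\mathbb{Z}_+=\{0,1,2,\dots\}$, $$\frac{\bar h(2r,\Gamma)}{2r}\ \ge\ h(\Gamma)\ \ge\ \frac{\bar h(p+2q,\Gamma)-\bar h(2q,\Gamma)}{p}.$$
   Context: Notation: $\langle n\rangle=\{1,\dots,n\}$; $\mathbf e_k$ is the $k$-th standard unit vector; for $\mathbf m=(m_1,\dots,m_d)\in\mathbb N^d$, $\langle\mathbf m\rangle=\langle m_1\rangle\times\cdots\times\langle m_d\rangle$ and $|\mathbf m|_{\mathrm{pr}}=m_1\cdots m_d$. A digraph $\Gamma_k\subseteq\langle n\rangle\times\langle n\rangle$ is symmetric if $(a,b)\in\Gamma_k\iff(b,a)\in\Gamma_k$. A $\Gamma$-configuration of $\langle\mathbf m\rangle$ is a map $\phi:\langle\mathbf m\rangle\to\langle n\rangle$ with $(\phi_{\mathbf i},\phi_{\mathbf i+\mathbf e_k})\in\Gamma_k$ whenever $\mathbf i,\mathbf i+\mathbf e_k\in\langle\mathbf m\rangle$; $W(\mathbf m)$ denotes the set of these. The entropy is $h(\Gamma)=\lim_{\mathbf m\to\infty}\frac{\log\#W(\mathbf m)}{|\mathbf m|_{\mathrm{pr}}}$ (this limit exists, in $[0,\infty)\cup\{-\infty\}$; $\mathbf m\to\infty$ means all coordinates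 tend to $\infty$). For $m_1\in\mathbb N$ and $\mathbf m^-=(m_2,\dots,m_d)\in\mathbb N^{d-1}$, $W_{\mathrm{per},\{1\}}(m_1,\mathbf m^-)$ is the set of $\phi\in W(m_1,\mathbf m^-)$ which additionally satisfy $(\phi_{(m_1,\mathbf j)},\phi_{(1,\mathbf j)})\in\Gamma_1$ for all $\mathbf j\in\langle\mathbf m^-\rangle$ (i.e. which extend periodically with period $m_1$ in direction $\mathbf e_1$); for $m_1=0$, $W_{\mathrm{per},\{1\}}(0,\mathbf m^-)$ is the set of $(\Gamma_2,\dots,\Gamma_d)$-configurations of $\langle\mathbf m^-\rangle$. For $m_1\in\mathbb Z_+$, $\bar h(m_1,\Gamma)=\lim_{\mathbf m^-\to\infty}\frac{\log\#W_{\mathrm{per},\{1\}}(m_1,\mathbf m^-)}{|\mathbf m^-|_{\mathrm{pr}}}$; this limit exists (it is the entropy of an associated $(d-1)$-dimensional system). *)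

(* Defs.v *)
From mathcomp Require Import all_boot all_order all_algebra.
From mathcomp Require Import all_classical all_reals all_analysis.

Set Implicit Arguments.
Unset Strict Implicit.
Unset Printing Implicit Defensive.

Import Order.TTheory GRing.Theory Num.Theory.
Import numFieldNormedType.Exports.

Local Open Scope ring_scope.

(* The box <m> = <m_1> x ... x <m_d>, with coordinates counted from 0: the
   k-th coordinate ranges over {0, ..., m_k - 1} instead of {1, ..., m_k}, and
   directions and colours are likewise elements of 'I_d and 'I_n. *)
Definition box d (m : 'I_d -> nat) : finType :=
  {dffun forall k : 'I_d, 'I_(m k)}.

Definition vol d (m : 'I_d -> nat) : nat := (\prod_(k < d) m k)%N.

(* i' = i + e_k *)
Definition is_shift d (m : 'I_d -> nat) (k : 'I_d) (i i' : box m) : bool :=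
  [forall l, i' l == (i l + (l == k))%N :> nat].

Definition is_config d n (Gam : 'I_d -> rel 'I_n) (m : 'I_d -> nat)
    (phi : {ffun box m -> 'I_n}) : bool :=
  [forall k, forall i, forall i', is_shift k i i' ==> Gam k (phi i) (phi i')].

Definition W d n (Gam : 'I_d -> rel 'I_n) (m : 'I_d -> nat) :
    {set {ffun box m -> 'I_n}} :=
  finset (fun phi => is_config Gam phi).

(* i = (m_1, j) and i' = (1, j) for a common j, in 1-based coordinates *)
Definition is_wrap d (m : 'I_d.+1 -> nat) (i i' : box m) : bool :=
  [&& (i ord0).+1 == m ord0, i' ord0 == 0%N :> nat
    & [forall l, (l != ord0) ==> (i l == i' l)]].

Definition Wwrap d n (Gam : 'I_d.+1 -> rel 'I_n) (m : 'I_d.+1 -> nat) :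
    {set {ffun box m -> 'I_n}} :=
  finset (fun phi => (phi \in W Gam m) &&
    [forall i, forall i', is_wrap i i' ==> Gam ord0 (phi i) (phi i')]).

(* (m_1, m^-) *)
Definition cons_size d (m1 : nat) (m : 'I_d -> nat) : 'I_d.+1 -> nat :=
  fun k => if unlift ord0 k is Some j then m j else m1.

(* (Gamma_2, ..., Gamma_d) *)
Definition tail_graphs d n (Gam : 'I_d.+1 -> rel 'I_n) : 'I_d -> rel 'I_n :=
  fun j => Gam (lift ord0 j).

(* # W_{per,{1}}(m_1, m^-); the case m_1 = 0 is a separate convention and does
   not count maps on an empty box. *)
Definition card_Wper d n (Gam : 'I_d.+1 -> rel 'I_n) (m1 : nat)
    (m : 'I_d -> nat) : nat :=
  if m1 == 0%N then #|W (tail_graphs Gam) m|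
  else #|Wwrap Gam (cons_size m1 m)|.

(* The filter "m -> oo": all coordinates tend to infinity. *)
Definition size_infty d : set_system ('I_d -> nat) :=
  filter_from setT (fun N : nat => [set m | forall k, (N <= m k)%N]%classic).

Lemma size_infty_proper d : ProperFilter (@size_infty d).
Proof.
apply: filter_from_proper; last by move=> N _; exists (fun=> N) => k /=.
apply: filter_from_filter; first by exists 0%N.
move=> N1 N2 _ _; exists (maxn N1 N2) => // m /= Nm.
by split=> k; apply: leq_trans (Nm k); rewrite ?leq_maxl ?leq_maxr.
Qed.
#[global] Existing Instance size_infty_proper.

(* lne 0 = -oo, so both limits below are taken in [-oo, +oo]. *)
Definition entropy (R : realType) d n (Gam : 'I_d -> rel 'I_n) : \bar R :=
  lim ((fun m : 'I_d -> nat =>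
          lne (#|W Gam m|%:R%:E) / (vol m)%:R%:E)%E @ @size_infty d)%classic.

Definition per_entropy (R : realType) d n (Gam : 'I_d.+1 -> rel 'I_n)
    (m1 : nat) : \bar R :=
  lim ((fun m : 'I_d -> nat =>
          lne ((card_Wper Gam m1 m)%:R%:E) / (vol m)%:R%:E)%E
       @ @size_infty d)%classic.

(* Main.v *)
Require Import Defs.
From mathcomp Require Import all_boot all_order all_algebra.
From mathcomp Require Import all_classical all_reals all_analysis.
From mathcomp Require Import zify ring lra.

(* For fixed m^- let A be the 0-1 matrix indexed by the configurations of <m^->
   whose entries record the Gamma_1-compatibility of two consecutive columns.
   Then #W_per(l, m^-) = tr A^l and #W(l + 1, m^-) is the sum of the entries of
   A^l.  As A is symmetric, the Cauchy-Schwarz inequality gives, without any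
   spectral theory,
     #W(2rk + 1, m^-) <= #W(m^-) (tr A^(2r))^k   and
     (tr A^(p + 2q))^(2^j) <= (tr A^(2q))^(2^j - 1) #W(2q + 2^j p + 1, m^-).
   Take logarithms, divide by the volume, let m^- -> oo, and then k -> oo or
   j -> oo.  The limits exist by a multidimensional Fekete lemma. *)

Set Implicit Arguments.
Unset Strict Implicit.
Unset Printing Implicit Defensive.

Import Order.TTheory GRing.Theory Num.Theory.
Import numFieldNormedType.Exports.

Local Open Scope nat_scope.

(** * Walks in a symmetric relation *)

Section Walks.
Variables (T : finType) (D : {set T}) (e : rel T).

(** Doubling both sides and expanding them as sums over pairs reduces the claim to
    [2 * u * v <= u ^ 2 + v ^ 2] with [u = f i * g j] and [v = f j * g i]; this avoids subtraction
    in [nat]. *)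
Lemma sum_Cauchy_nat (I : finType) (P : pred I) (f g : I -> nat) :
  (\sum_(i | P i) f i * g i) ^ 2 <=
  (\sum_(i | P i) f i ^ 2) * (\sum_(i | P i) g i ^ 2).
Proof.
rewrite -(leq_pmul2l (isT : 0 < 2)).
rewrite -mulnn !big_distrlr /= mul2n -addnn mul2n -addnn.
rewrite [X in _ <= _ + X]exchange_big /= -!big_split /=.
apply: leq_sum => i _; rewrite -!big_split /=; apply: leq_sum => j _.
rewrite addnn -mul2n.
have := nat_Cauchy (f i * g j) (f j * g i); rewrite !expnMn.
by move=> h; apply: leq_trans h; rewrite mulnACA [g i * _]mulnC mulnACA.
Qed.

(** The [(x, y)] entry of the [l]-th power of the matrix of [e] on [D]. The starting point [x] is
    not tested for membership in [D], whence the assumptions [x \in D] below. *)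
Fixpoint nwalks (l : nat) (x y : T) : nat :=
  if l is l'.+1 then \sum_(z in D) e x z * nwalks l' z y else x == y.

(* The trace of the l-th power of e restricted to D. *)
Definition nclosed (l : nat) : nat := \sum_(x in D) nwalks l x x.

Lemma nwalksD a b x y : x \in D ->
  nwalks (a + b) x y = \sum_(z in D) nwalks a x z * nwalks b z y.
Proof.
elim: a x => [|a IH] x xD /=.
  rewrite (bigD1 x) //= eqxx mul1n big1 ?addn0 // => z /andP[_ zx].
  by rewrite eq_sym (negbTE zx).
under eq_bigr => z zD do rewrite IH // big_distrr /=.
rewrite exchange_big /=; apply: eq_bigr => z _.
by rewrite big_distrl /=; apply: eq_bigr => t _; rewrite mulnA.
Qed.

Lemma nwalks1 x y : x \in D -> y \in D -> nwalks 1 x y = e x y.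
Proof.
move=> xD yD /=; rewrite (bigD1 y) //= eqxx muln1 big1 ?addn0 // => z /andP[_ zy].
by rewrite (negbTE zy) muln0.
Qed.

Lemma nwalks_sym l x y : symmetric e -> x \in D -> y \in D ->
  nwalks l x y = nwalks l y x.
Proof.
move=> es; elim: l x y => [|l IH] x y xD yD; first by rewrite /= eq_sym.
rewrite -[in RHS]addn1 nwalksD // [LHS]/=; apply: eq_bigr => z zD.
by rewrite nwalks1 // es IH // mulnC.
Qed.

Lemma nclosedD a b : symmetric e ->
  nclosed (a + b) = \sum_(x in D) \sum_(z in D) nwalks a x z * nwalks b x z.
Proof.
move=> es; apply: eq_bigr => x xD; rewrite nwalksD //.
by apply: eq_bigr => z zD; rewrite (nwalks_sym b es xD).
Qed.

Lemma nclosed_double a : symmetric e ->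
  nclosed (2 * a) = \sum_(x in D) \sum_(z in D) nwalks a x z ^ 2.
Proof. by move=> es; rewrite mul2n -addnn nclosedD. Qed.

(** By symmetry, [nclosed (a + b)] is the Frobenius inner product of the powers A^a and A^b, and
    [nclosed (2 * a)] is the squared Frobenius norm of A^a. *)
Lemma nclosed_Cauchy a b : symmetric e ->
  nclosed (a + b) ^ 2 <= nclosed (2 * a) * nclosed (2 * b).
Proof.
move=> es; rewrite nclosedD // !nclosed_double // !pair_big /=.
exact: sum_Cauchy_nat.
Qed.

(** Submultiplicativity of the Frobenius norm: Cauchy-Schwarz is applied to each entry of A^a A^b,
    as a row times a column. *)
Lemma nclosed_submul a b : symmetric e ->
  nclosed (2 * (a + b)) <= nclosed (2 * a) * nclosed (2 * b).
Proof.
move=> es; rewrite !nclosed_double // [X in _ <= _ * X]exchange_big /=.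
rewrite big_distrlr /=; apply: leq_sum => x xD; apply: leq_sum => y yD.
by rewrite nwalksD //; exact: sum_Cauchy_nat.
Qed.

Lemma nclosed_exp r k : symmetric e -> 0 < k ->
  nclosed (2 * r * k) <= nclosed (2 * r) ^ k.
Proof.
move=> es; elim: k => [//|[|k] IH] _; first by rewrite muln1 expn1.
rewrite -mulnA mulnS expnS (leq_trans (nclosed_submul _ _ es)) //.
by rewrite leq_mul2l mulnA IH ?orbT.
Qed.

(** The sum of the entries of A^(2s) is the squared norm of A^s applied to the all-ones vector. Each
    coordinate of that vector is bounded by Cauchy-Schwarz against the constant 1, which produces
    the factor [#|D|]. *)
Lemma sum_nwalks_le s : symmetric e ->
  \sum_(x in D) \sum_(y in D) nwalks (2 * s) x y <= #|D| * nclosed (2 * s).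
Proof.
move=> es; rewrite nclosed_double //.
under eq_bigr => x xD.
  under eq_bigr => y yD do rewrite mul2n -addnn nwalksD //.
  rewrite exchange_big /=; under eq_bigr => y yD do rewrite -big_distrr /=.
  over.
rewrite exchange_big /= big_distrr /=; apply: leq_sum => z zD.
rewrite -big_distrl /=; under eq_bigr => x xD do rewrite (nwalks_sym s es xD zD).
rewrite mulnn; have := sum_Cauchy_nat (mem D) (fun=> 1) (nwalks s z).
by under eq_bigr => x _ do rewrite mul1n; rewrite sum_nat_const muln1.
Qed.

(** Induction on [j]: square the inequality, then apply [nclosed_Cauchy] to the split of
    [2 * q + 2 ^ j * p] into [q] and [q + 2 ^ j * p]. This keeps the defect [2 * q] fixed while the
    other exponent doubles. *)
Lemma nclosed_growth p q j : symmetric e ->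
  nclosed (p + 2 * q) ^ (2 ^ j) <=
  nclosed (2 * q) ^ (2 ^ j - 1) * nclosed (2 * q + 2 ^ j * p).
Proof.
move=> es; elim: j => [|j IH]; first by rewrite !expn0 expn1 !mul1n addnC.
rewrite [in X in X <= _]expnSr expnM.
have /leq_trans -> // : (nclosed (p + 2 * q) ^ 2 ^ j) ^ 2 <=
  (nclosed (2 * q) ^ (2 ^ j - 1) * nclosed (2 * q + 2 ^ j * p)) ^ 2.
  by rewrite leq_exp2r.
have j0 : 0 < 2 ^ j by rewrite expn_gt0.
rewrite expnMn -expnM.
have -> : 2 ^ j.+1 - 1 = (2 ^ j - 1) * 2 + 1 by rewrite expnS; lia.
rewrite expnD expn1 -mulnA leq_mul2l; apply/orP; right.
have -> : 2 * q + 2 ^ j * p = q + (q + 2 ^ j * p) by lia.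
have -> : 2 * q + 2 ^ j.+1 * p = 2 * (q + 2 ^ j * p) by rewrite expnS; lia.
exact: nclosed_Cauchy.
Qed.

Lemma big_tupleS (l : nat) (F : l.+1.-tuple T -> nat) :
  \sum_(t : l.+1.-tuple T) F t =
  \sum_(x : T) \sum_(t : l.-tuple T) F [tuple of x :: t].
Proof.
rewrite pair_big /=.
rewrite (reindex (fun xt : T * l.-tuple T => [tuple of xt.1 :: xt.2])) //=.
exists (fun t => (thead t, [tuple of behead t])) => [[x t] _|t _] /=.
  by congr (_, _); apply: val_inj.
by rewrite -tuple_eta.
Qed.

(** The weight [g] on the endpoint serves two counts: [g = 1] gives all walks, and [g y = e y x]
    closes the walk up to a cycle. *)
Lemma sum_path l x (g : T -> nat) : x \in D ->
  \sum_(t : l.-tuple T | all (mem D) t && path e x t) g (last x t) =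
  \sum_(y in D) nwalks l x y * g y.
Proof.
elim: l x => [|l IH] x xD.
  rewrite (bigD1 [tuple]) //= [RHS](bigD1 x) //= (eqxx x) mul1n !big1 ?addn0 //.
    by move=> y /andP[_ yx]; rewrite eq_sym (negbTE yx).
  by move=> t /andP[_ /eqP[]]; exact: tuple0.
rewrite big_mkcond big_tupleS /=.
under [RHS]eq_bigr => y _ do rewrite big_distrl /=.
rewrite [RHS]exchange_big [RHS]big_mkcond /=.
apply: eq_bigr => z _; case: ifP => zD /=; last first.
  by rewrite big1 // => t _; rewrite (negbTE (negbT zD)).
under eq_bigr => t _ do rewrite andbCA.
case: (e x z) => /=; last by rewrite big1_eq big1 // => y _; rewrite mul0n.
by rewrite -big_mkcond /= IH //; apply: eq_bigr => y _; rewrite mul1n.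
Qed.

Lemma card_sorted l :
  #|[set t : l.+1.-tuple T | all (mem D) t && sorted e t]| =
  \sum_(x in D) \sum_(y in D) nwalks l x y.
Proof.
rewrite -sum1_card (eq_bigl _ _ (fun t => finset.in_set _ t)) big_mkcond big_tupleS.
rewrite [RHS]big_mkcond; apply: eq_bigr => x _ /=; case: ifP => xD /=; last first.
  by rewrite big1.
rewrite -big_mkcond (sum_path l (fun=> 1) xD).
by apply: eq_bigr => y _; rewrite muln1.
Qed.

Lemma card_cycle l :
  #|[set t : l.+1.-tuple T | all (mem D) t && cycle e t]| = nclosed l.+1.
Proof.
rewrite -sum1_card (eq_bigl _ _ (fun t => finset.in_set _ t)) big_mkcond big_tupleS.
rewrite /nclosed [RHS]big_mkcond; apply: eq_bigr => x _.
case: ifP => xD; last by rewrite big1 //= => t _; rewrite xD.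
rewrite -[in RHS]addn1 nwalksD //; under [RHS]eq_bigr => z zD do rewrite nwalks1 //.
rewrite -(sum_path l (fun y => e y x) xD) [RHS]big_mkcond; apply: eq_bigr => t _.
by rewrite /= xD rcons_path andbA -if_and.
Qed.

End Walks.

(** * Submultiplicativity of the counting functions *)

Definition update d (m : 'I_d -> nat) (k : 'I_d) (a : nat) : 'I_d -> nat :=
  fun l => if l == k then a else m l.

Lemma update_eq d (m : 'I_d -> nat) k a : update m k a k = a.
Proof. by rewrite /update eqxx. Qed.

Lemma update_neq d (m : 'I_d -> nat) k a l : l != k -> update m k a l = m l.
Proof. by rewrite /update => /negbTE ->. Qed.

(** Points are built from natural-number coordinates and compared through [box_ext], so that no
    equality between the dependent types ['I_(m k)] is ever needed. *)
Definition mkbox d (m : 'I_d -> nat) (v : 'I_d -> nat)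
    (h : forall k, v k < m k) : box m :=
  [ffun k => Ordinal (h k)].

Lemma mkboxE d (m v : 'I_d -> nat) (h : forall k, v k < m k) k :
  mkbox h k = v k :> nat.
Proof. by rewrite ffunE. Qed.

Lemma box_ext d (m : 'I_d -> nat) (i j : box m) :
  (forall k, i k = j k :> nat) -> i = j.
Proof. by move=> h; apply/ffunP => k; apply: val_inj; exact: h. Qed.

Section Restriction.
Variables (d n : nat) (m m' t : 'I_d -> nat).
Hypothesis tm : forall k, t k + m' k <= m k.

Lemma translate_subproof (i : box m') k : t k + i k < m k.
Proof. by apply: leq_trans (tm k); rewrite ltn_add2l. Qed.

(** The embedding of the smaller box as the sub-box with corner [t]. *)
Definition translate (i : box m') : box m := mkbox (translate_subproof i).

Definition restriction (phi : {ffun box m -> 'I_n}) : {ffun box m' -> 'I_n} :=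
  [ffun i => phi (translate i)].

Lemma restriction_config (Gam : 'I_d -> rel 'I_n) phi :
  phi \in W Gam m -> restriction phi \in W Gam m'.
Proof.
rewrite !inE => /forallP h; apply/forallP => k; apply/forallP => i.
apply/forallP => i'; apply/implyP => /forallP ii'; rewrite !ffunE.
move/forallP: (h k) => /(_ (translate i)) /forallP /(_ (translate i')) /implyP.
apply; apply/forallP => l; rewrite !mkboxE (eqP (ii' l)) addnA eqxx //.
Qed.

End Restriction.

(** The wrap condition survives because the sub-box spans the whole first direction: its first and
    last layers are those of the large box. *)
Lemma restriction_wrap d n (m m' t : 'I_d.+1 -> nat)
    (tm : forall k, t k + m' k <= m k) (Gam : 'I_d.+1 -> rel 'I_n) phi :
  t ord0 = 0 -> m' ord0 = m ord0 ->
  phi \in Wwrap Gam m -> restriction tm phi \in Wwrap Gam m'.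
Proof.
move=> t0 m0; rewrite !inE => /andP[h /forallP w].
have := @restriction_config _ n _ _ _ tm Gam phi; rewrite !inE => -> //=.
apply/forallP => i; apply/forallP => i'.
apply/implyP => /and3P[/eqP i0 i'0 /forallP ii']; rewrite !ffunE.
move/forallP: (w (translate tm i)) => /(_ (translate tm i')) /implyP.
apply; apply/and3P; split; rewrite ?mkboxE ?t0 //.
  by rewrite -m0 add0n i0.
apply/forallP => l; apply/implyP => l0; apply/eqP/val_inj => /=.
by rewrite !mkboxE; have /implyP/(_ l0)/eqP -> := ii' l.
Qed.

Section Submultiplicative.
Variables (d n : nat) (m : 'I_d -> nat) (k : 'I_d) (a b : nat).

Lemma lower_subproof l : (fun=> 0) l + update m k a l <= update m k (a + b) l.
Proof. by rewrite /update add0n; case: eqP => // _; exact: leq_addr. Qed.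

Lemma upper_subproof l :
  update (fun=> 0) k a l + update m k b l <= update m k (a + b) l.
Proof. by rewrite /update; case: eqP. Qed.

Definition halves (phi : {ffun box (update m k (a + b)) -> 'I_n}) :=
  (restriction lower_subproof phi, restriction upper_subproof phi).

(** The box is cut orthogonally to direction [k] at height [a]. Every point lies in one of the two
    pieces, so a configuration is determined by its two restrictions. *)
Lemma halves_inj : injective halves.
Proof.
move=> phi psi [/ffunP lo /ffunP hi]; apply/ffunP => i.
have [ia|ia] := ltnP (i k) a.
  have h l : i l < update m k a l.
    case: (eqVneq l k) => [->|lk]; first by rewrite (update_eq m k a).
    by have := ltn_ord (i l); move: (nat_of_ord _) => x; rewrite !update_neq.
  have := lo (mkbox h); rewrite !ffunE.
  suff -> : translate lower_subproof (mkbox h) = i by [].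
  by apply: box_ext => l; rewrite !mkboxE.
have h l : i l - update (fun=> 0) k a l < update m k b l.
  case: (eqVneq l k) => [->|lk].
    rewrite (update_eq _ k a) (update_eq _ k b).
    have: i k < a + b by apply: leq_trans (ltn_ord (i k)) _; rewrite update_eq.
    by move: ia; lia.
  by have := ltn_ord (i l); move: (nat_of_ord _) => x; rewrite !update_neq ?subn0.
have := hi (mkbox h); rewrite !ffunE.
suff -> : translate upper_subproof (mkbox h) = i by [].
apply: box_ext => l; rewrite !mkboxE subnKC //.
by case: (eqVneq l k) => [->|lk]; rewrite ?update_eq ?update_neq.
Qed.

Lemma card_W_submul (Gam : 'I_d -> rel 'I_n) :
  #|W Gam (update m k (a + b))| <=
  #|W Gam (update m k a)| * #|W Gam (update m k b)|.
Proof.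
rewrite -finset.cardsX -(card_imset _ halves_inj); apply: subset_leq_card.
apply/fintype.subsetP => _ /imsetP[phi h ->].
by rewrite finset.in_setX; apply/andP; split; exact: restriction_config.
Qed.

End Submultiplicative.

Lemma card_Wwrap_submul d n (Gam : 'I_d.+1 -> rel 'I_n) m k a b :
  k != ord0 ->
  #|Wwrap Gam (update m k (a + b))| <=
  #|Wwrap Gam (update m k a)| * #|Wwrap Gam (update m k b)|.
Proof.
move=> k0; rewrite -finset.cardsX -(card_imset _ (@halves_inj _ _ _ _ _ _)).
apply: subset_leq_card; apply/fintype.subsetP => _ /imsetP[phi h ->].
rewrite finset.in_setX; apply/andP; split; apply: restriction_wrap => //;
  by rewrite /update eq_sym (negbTE k0).
Qed.

Lemma update_cons_size d m1 (m : 'I_d -> nat) k a :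
  update (cons_size m1 m) (lift ord0 k) a = cons_size m1 (update m k a).
Proof.
apply/funext => l; rewrite /update /cons_size.
case: unliftP => [j ->|->]; first by rewrite (inj_eq lift_inj).
by rewrite (negbTE (neq_lift _ _)).
Qed.

Lemma card_Wper_submul d n (Gam : 'I_d.+1 -> rel 'I_n) m1 m k a b :
  card_Wper Gam m1 (update m k (a + b)) <=
  card_Wper Gam m1 (update m k a) * card_Wper Gam m1 (update m k b).
Proof.
rewrite /card_Wper; case: ifP => _; first exact: card_W_submul.
by rewrite -!update_cons_size; apply: card_Wwrap_submul; rewrite eq_sym neq_lift.
Qed.

Lemma card_box d (m : 'I_d -> nat) : #|box m| = vol m.
Proof.
rewrite /box /vol; rewrite card_dep_ffun.
rewrite foldrE big_map -big_enum /=. 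
by apply: eq_bigr => k _; rewrite card_ord.
Qed.

Lemma card_W_le d n (Gam : 'I_d -> rel 'I_n) m : #|W Gam m| <= n ^ vol m.
Proof.
by apply: leq_trans (max_card _) _; rewrite card_ffun card_ord card_box.
Qed.

Lemma vol_cons_size d m1 (m : 'I_d -> nat) : vol (cons_size m1 m) = m1 * vol m.
Proof.
rewrite /vol big_ord_recl /cons_size unlift_none; congr (_ * _).
by apply: eq_bigr => k _; rewrite liftK.
Qed.

(** The exponent [m1.+1], instead of [m1], makes the bound cover [m1 = 0] as well, where colourings
    of the box [m] itself are counted. *)
Lemma card_Wper_le d n (Gam : 'I_d.+1 -> rel 'I_n) m1 m : 0 < n ->
  card_Wper Gam m1 m <= (n ^ m1.+1) ^ vol m.
Proof.
move=> n0; rewrite /card_Wper -expnM; case: ifP => [/eqP ->|_].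
  by rewrite mul1n card_W_le.
apply: leq_trans (_ : #|W Gam (cons_size m1 m)| <= _).
  by apply/subset_leq_card/fintype.subsetP => phi; rewrite inE => /andP[].
apply: leq_trans (card_W_le _ _) _; rewrite vol_cons_size leq_pexp2l //.
by rewrite leq_mul2r leqnSn orbT.
Qed.

(** * Configurations as walks on columns *)

Section Columns.
Variables (d n m1 : nat) (m : 'I_d -> nat).

Lemma consbox_subproof (a : 'I_m1) (j : box m) k :
  (if unlift ord0 k is Some k' then j k' : nat else a) < cons_size m1 m k.
Proof. by rewrite /cons_size; case: unliftP => [k'|] _; exact: ltn_ord. Qed.

Definition consbox (a : 'I_m1) (j : box m) : box (cons_size m1 m) :=
  mkbox (consbox_subproof a j).

Lemma consbox0 a j : consbox a j ord0 = a :> nat.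
Proof. by rewrite mkboxE unlift_none. Qed.

Lemma consboxS a j k : consbox a j (lift ord0 k) = j k :> nat.
Proof. by rewrite mkboxE liftK. Qed.

Lemma headbox_subproof (i : box (cons_size m1 m)) : i ord0 < m1.
Proof.
(* The value is generalized first: the type of [i ord0] mentions [cons_size], which would obstruct
   rewriting the bound. *)
have := ltn_ord (i ord0); move: (nat_of_ord _) => a.
by rewrite /cons_size unlift_none.
Qed.

Definition headbox (i : box (cons_size m1 m)) := Ordinal (headbox_subproof i).

Lemma tailbox_subproof (i : box (cons_size m1 m)) k : i (lift ord0 k) < m k.
Proof. have := ltn_ord (i (lift ord0 k)); move: (nat_of_ord _) => a.
by rewrite /cons_size liftK. Qed.

Definition tailbox (i : box (cons_size m1 m)) : box m :=
  mkbox (tailbox_subproof i).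

Lemma headtailK i : consbox (headbox i) (tailbox i) = i.
Proof.
apply: box_ext => k; case: (unliftP ord0 k) => [k' ->|->].
  by rewrite consboxS mkboxE.
by rewrite consbox0.
Qed.

Lemma headboxK a j : headbox (consbox a j) = a.
Proof. by apply: val_inj; rewrite /= consbox0. Qed.

Lemma tailboxK a j : tailbox (consbox a j) = j.
Proof. by apply: box_ext => k; rewrite mkboxE consboxS. Qed.

Definition column (phi : {ffun box (cons_size m1 m) -> 'I_n}) (a : 'I_m1) :
  {ffun box m -> 'I_n} := [ffun j => phi (consbox a j)].

Definition columns phi := [tuple column phi a | a < m1].

Lemma columns_bij : bijective columns.
Proof.
exists (fun t : m1.-tuple {ffun box m -> 'I_n} =>
  [ffun i => tnth t (headbox i) (tailbox i)]) => [phi|t].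
  by apply/ffunP => i; rewrite ffunE tnth_mktuple ffunE headtailK.
apply: eq_from_tnth => a; rewrite tnth_mktuple; apply/ffunP => j.
by rewrite !ffunE headboxK tailboxK.
Qed.

Variable Gam : 'I_d.+1 -> rel 'I_n.

(** The transfer matrix in the first direction, as a relation between columns. *)
Definition adjacent (x y : {ffun box m -> 'I_n}) : bool :=
  [forall j, Gam ord0 (x j) (y j)].

Lemma adjacent_sym : symmetric (Gam ord0) -> symmetric adjacent.
Proof. by move=> gs x y; apply: eq_forallb => j; rewrite gs. Qed.

(** A shift in a direction [lift ord0 k] stays inside one column, while a shift in direction [ord0]
    joins equal positions of consecutive columns. *)
Lemma config_columns phi :
  phi \in W Gam (cons_size m1 m) <->
  (forall a, column phi a \in W (tail_graphs Gam) m) /\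
  (forall a a' : 'I_m1, a' = a.+1 :> nat ->
     adjacent (column phi a) (column phi a')).
Proof.
rewrite inE; split=> [/forallP h|[h1 h2]].
  split=> [a|a a' aa'].
    rewrite inE; apply/forallP => k; apply/forallP => j; apply/forallP => j'.
    apply/implyP => /forallP jj'; rewrite !ffunE.
    move/forallP: (h (lift ord0 k)) => /(_ (consbox a j)).
    move=> /forallP /(_ (consbox a j')) /implyP; apply; apply/forallP => l.
    case: (unliftP ord0 l) => [l' ->|->].
      by rewrite !consboxS (eqP (jj' l')) (inj_eq lift_inj).
    by rewrite !consbox0 addn0.
  apply/forallP => j; rewrite !ffunE.
  move/forallP: (h ord0) => /(_ (consbox a j)).
  move=> /forallP /(_ (consbox a' j)) /implyP; apply; apply/forallP => l.
  case: (unliftP ord0 l) => [l' ->|->].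
    by rewrite !consboxS addn0.
  by rewrite !consbox0 aa' addn1.
apply/forallP => k; apply/forallP => i; apply/forallP => i'; apply/implyP.
move=> /forallP ii'; rewrite -(headtailK i) -(headtailK i').
case: (unliftP ord0 k) => [k' kE|kE]; subst k.
  have -> : headbox i' = headbox i.
    by apply: val_inj; rewrite /= (eqP (ii' ord0)) addn0.
  have := h1 (headbox i); rewrite inE => /forallP /(_ k') /forallP.
  move=> /(_ (tailbox i)) /forallP /(_ (tailbox i')) /implyP.
  rewrite !ffunE; apply; apply/forallP => l.
  by rewrite !mkboxE (eqP (ii' _)) (inj_eq lift_inj).
have -> : tailbox i' = tailbox i.
  by apply: box_ext => l; rewrite !mkboxE (eqP (ii' _)) addn0.
have /h2/forallP/(_ (tailbox i)) : headbox i' = (headbox i).+1 :> nat.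
  by rewrite /= (eqP (ii' _)) eqxx addn1.
by rewrite !ffunE.
Qed.

Lemma wrap_columns phi :
  phi \in Wwrap Gam (cons_size m1 m) <->
  phi \in W Gam (cons_size m1 m) /\
  (forall a a' : 'I_m1, a.+1 = m1 -> a' = 0 :> nat ->
     adjacent (column phi a) (column phi a')).
Proof.
rewrite /Wwrap finset.in_set; split=> [/andP[-> /forallP h]|[-> h]].
  split=> // a a' aE a'E; apply/forallP => j; rewrite !ffunE.
  move/forallP: (h (consbox a j)) => /(_ (consbox a' j)) /implyP; apply.
  apply/and3P; split; rewrite ?consbox0 ?a'E //.
    by rewrite aE /cons_size unlift_none.
  apply/forallP => l; apply/implyP => l0; apply/eqP/val_inj => /=.
  case: (unliftP ord0 l) l0 => [l' ->|->]; last by rewrite eqxx.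
  by rewrite !consboxS.
apply/forallP => i; apply/forallP => i'.
apply/implyP => /and3P[/eqP i0 /eqP i'0 /forallP ii'].
rewrite -(headtailK i) -(headtailK i').
have -> : tailbox i' = tailbox i.
  apply: box_ext => l; rewrite !mkboxE.
  by have /implyP/(_ isT)/eqP -> := ii' (lift ord0 l).
have w : (headbox i).+1 = m1 by rewrite /= i0 /cons_size unlift_none.
have /forallP/(_ (tailbox i)) := h _ (headbox i') w i'0.
by rewrite !ffunE.
Qed.

End Columns.

(** * Transfer-matrix formulas for the two counting functions *)

Section Count.
Variables (d n : nat) (m : 'I_d -> nat) (Gam : 'I_d.+1 -> rel 'I_n).
Let D := W (tail_graphs Gam) m.
Let e := @adjacent d n m Gam.

Lemma columns_W l phi :
  (phi \in W Gam (cons_size l.+1 m)) =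
  all (mem D) (columns phi) && sorted e (columns phi).
Proof.
apply/idP/andP => [/config_columns[h1 h2]|
  [/all_tnthP h1 /(sortedP (column phi ord0)) h2]].
  split; first by apply/all_tnthP => a; rewrite tnth_mktuple; exact: h1.
  apply/(sortedP (column phi ord0)) => a; rewrite size_tuple => al.
  rewrite (nth_mktuple _ _ (Ordinal (ltnW al))) (nth_mktuple _ _ (Ordinal al)).
  exact: (h2 (Ordinal (ltnW al)) (Ordinal al) erefl).
apply/config_columns; split=> [a|a a' aa']; first by have := h1 a; rewrite tnth_mktuple.
have := h2 a; rewrite size_tuple -aa' ltn_ord !nth_mktuple; exact.
Qed.

Lemma columns_Wwrap l phi :
  (phi \in Wwrap Gam (cons_size l.+1 m)) =
  all (mem D) (columns phi) && cycle e (columns phi).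
Proof.
(* A cycle is a path together with the edge from its last to its first vertex; that edge is the wrap
   condition. *)
have cycleE : cycle e (columns phi) =
    sorted e (columns phi) && e (column phi ord_max) (column phi ord0).
  have tE a : column phi a = tnth (columns phi) a by rewrite tnth_mktuple.
  rewrite !tE; case/tupleP: (columns phi) => x s.
  by rewrite !(tnth_nth x) /= rcons_path (last_nth x) size_tuple.
rewrite cycleE andbA -columns_W; apply/idP/andP => [/wrap_columns[-> h]|[hW h]].
  by split=> //; apply: h.
apply/wrap_columns; split=> // a a' aE a'E.
have -> : a = ord_max by apply: val_inj; case: aE.
by have -> : a' = ord0 by exact: val_inj.
Qed.

Lemma card_W_cons l :
  #|W Gam (cons_size l.+1 m)| = \sum_(x in D) \sum_(y in D) nwalks D e l x y.
Proof.
rewrite -card_sorted -(on_card_preimset (onW_bij _ (@columns_bij _ _ _ _))).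
by apply: eq_card => phi; rewrite columns_W !inE.
Qed.

(** The convention for [l = 0] agrees with the trace of the identity, which is [#|D|]; this lets
    [q = 0] be treated uniformly. *)
Lemma card_WperE l : card_Wper Gam l m = nclosed D e l.
Proof.
case: l => [|l]; rewrite /card_Wper /=.
  by rewrite -sum1_card; apply: eq_bigr => x _ /=; rewrite eqxx.
rewrite -card_cycle -(on_card_preimset (onW_bij _ (@columns_bij _ _ _ _))).
by apply: eq_card => phi; rewrite columns_Wwrap !inE.
Qed.

Hypothesis hsym : symmetric (Gam ord0).

(** A row of [2 * r * k + 1] columns is a walk with [2 * r * k] steps, so [sum_nwalks_le] applies
    with [s = r * k], followed by [nclosed_exp]. *)
Lemma card_W_le_Wper r k : 0 < k ->
  #|W Gam (cons_size (2 * r * k).+1 m)| <=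
  card_Wper Gam 0 m * card_Wper Gam (2 * r) m ^ k.
Proof.
move=> k0; have es := @adjacent_sym _ _ m _ hsym.
rewrite card_W_cons !card_WperE -mulnA (leq_trans (sum_nwalks_le D _ es)) //.
rewrite -card_WperE /card_Wper eqxx leq_mul2l mulnA nclosed_exp ?orbT //.
Qed.

Lemma card_Wper_growth p q j :
  card_Wper Gam (p + 2 * q) m ^ (2 ^ j) <=
  card_Wper Gam (2 * q) m ^ (2 ^ j - 1) *
  #|W Gam (cons_size (2 * q + 2 ^ j * p).+1 m)|.
Proof.
have es := @adjacent_sym _ _ m _ hsym.
rewrite card_W_cons !card_WperE (leq_trans (nclosed_growth D p q j es)) //.
(* The trace is at most the sum of all entries. *)
rewrite leq_mul2l; apply/orP; right; apply: leq_sum => x xD.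
by rewrite (bigD1 x) //= leq_addr.
Qed.

(** The case [j = 1] of [nclosed_growth]. It ensures that positivity of the count for [p + 2 * q]
    passes to the one for [2 * q]. *)
Lemma card_Wper_eq0 p q :
  card_Wper Gam (2 * q) m = 0 -> card_Wper Gam (p + 2 * q) m = 0.
Proof.
have es := @adjacent_sym _ _ m _ hsym.
move=> q0; have := nclosed_growth (W (tail_graphs Gam) m) p q 1 es.
by rewrite -!card_WperE q0 mul0n leqn0 expn_eq0 andbT => /eqP.
Qed.

End Count.

Local Open Scope ring_scope.

(** * Growth rates of submultiplicative functions *)

Section Fekete.
Variables (R : realType) (d : nat) (f : ('I_d -> nat) -> nat) (C : nat).
Hypothesis C_gt0 : (0 < C)%N.
Hypothesis f_le : forall m, (f m <= C ^ vol m)%N.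
Hypothesis f_submul : forall m k a b,
  (f (update m k (a + b)) <= f (update m k a) * f (update m k b))%N.

(** Since [ln] is 0 at 0, this real number is the intended rate only where [f] is positive;
    vanishing [f] is split off in [growth_dichotomy]. *)
Definition density (m : 'I_d -> nat) : R := ln (f m)%:R / (vol m)%:R.

Lemma update_id m k : update m k (m k) = m :> ('I_d -> nat).
Proof. by apply/funext => l; rewrite /update; case: eqP => [->|]. Qed.

Lemma vol_update m k a : vol (update m k a) = (a * \prod_(l < d | l != k) m l)%N.
Proof.
rewrite /vol (bigD1 k) //= update_eq; congr (_ * _)%N.
by apply: eq_bigr => l lk; rewrite update_neq.
Qed.

Lemma vol_gt0 (m : 'I_d -> nat) : (forall k, 0 < m k)%N -> (0 < vol m)%N.
Proof. by move=> m0; rewrite /vol prodn_gt0. Qed.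

Lemma submul_muln m k q a s :
  (f (update m k (q * a + s)) <= f (update m k a) ^ q * f (update m k s))%N.
Proof.
elim: q => [|q IH]; first by rewrite mul0n mul1n.
rewrite mulSn -addnA expnS -mulnA (leq_trans (f_submul _ _ _ _)) //.
by rewrite leq_mul2l IH orbT.
Qed.

(** Side [k] is cut into [m k %/ a] blocks of length [a]; the remainder, shorter than [a], is
    estimated by the trivial bound [f_le]. *)
Lemma submul_division m k a : (0 < a)%N ->
  (f m <=
   f (update m k a) ^ (m k %/ a) * C ^ (a * \prod_(l < d | l != k) m l))%N.
Proof.
move=> a0; rewrite -{1}(update_id m k) {1}(divn_eq (m k) a).
apply: leq_trans (submul_muln _ _ _ _ _) _; rewrite leq_mul2l.
apply/orP; right; apply: leq_trans (f_le _) _; rewrite vol_update.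
by rewrite leq_pexp2l // leq_mul2r ltnW ?ltn_mod ?orbT.
Qed.

(* The proof changes the coordinates of m into those of M one at a time. *)
Lemma submul_eq0_above M : (forall k, 0 < M k)%N -> f M = 0%N ->
  forall m, (forall k, M k <= m k)%N -> f m = 0%N.
Proof.
move=> M0 fM m Mm.
pose mix (s : seq 'I_d) k := if k \in s then M k else m k.
suff H s : f (mix s) = 0%N -> f (mix [::]) = 0%N.
  apply: (H (enum 'I_d)); rewrite -{}fM; congr f; apply/funext => k.
  by rewrite /mix mem_enum.
elim: s => [//|k s IH] fs; apply: IH; apply/eqP.
rewrite -leqn0 (leq_trans (submul_division (mix s) k (M0 k))) //.
have -> : update (mix s) k (M k) = mix (k :: s).
  by apply/funext => l; rewrite /update /mix in_cons; case: eqVneq => [->|].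
rewrite fs exp0n ?mul0n // divn_gt0 // /mix.
by case: ifP.
Qed.

Hypothesis f_gt0 : forall m, (forall k, 0 < m k)%N -> (0 < f m)%N.

Lemma density_ge0 m : (forall k, 0 < m k)%N -> 0 <= density m.
Proof.
by move=> m0; rewrite divr_ge0 ?ler0n // ln_ge0 // ler1n f_gt0.
Qed.

Lemma density_step m k a : (forall l, 0 < m l)%N -> (0 < a)%N ->
  density m <= density (update m k a) + ln C%:R * (a%:R / (m k)%:R).
Proof.
move=> m0 a0.
have u0 : (forall l, 0 < update m k a l)%N.
  by move=> l; rewrite /update; case: ifP.
(* Nonnegativity allows the factor [(m k %/ a) * a] to be replaced by the larger [m k] below. *)
have D0 := density_ge0 u0.
set V := (\prod_(l < d | l != k) m l)%N.
have V0 : (0 < V)%N by rewrite prodn_gt0.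
have vm : vol m = (m k * V)%N by rewrite -{1}(update_id m k) vol_update.
have lnf : ln (f m)%:R <= (m k %/ a)%:R * ln (f (update m k a))%:R
    + (a * V)%:R * ln C%:R :> R.
  have fu0 : 0 < (f (update m k a))%:R :> R by rewrite ltr0n f_gt0.
  have C0 : 0 < C%:R :> R by rewrite ltr0n.
  rewrite !mulr_natl -!lnXn // -lnM ?posrE ?exprn_gt0 //.
  rewrite ler_ln ?posrE ?mulr_gt0 ?exprn_gt0 ?ltr0n ?f_gt0 //.
  by rewrite -!natrX -natrM ler_nat submul_division.
have mk0 : 0 < (m k)%:R :> R by rewrite ltr0n.
have VR0 : 0 < V%:R :> R by rewrite ltr0n.
have aR0 : 0 < a%:R :> R by rewrite ltr0n.
have uE : ln (f (update m k a))%:R = density (update m k a) * (a%:R * V%:R).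
  by rewrite /density vol_update -/V natrM divfK // mulf_neq0 // gt_eqF.
rewrite uE in lnf.
rewrite {1}/density vm natrM ler_pdivrMr ?mulr_gt0 // mulrDl.
apply: le_trans lnf _; apply: lerD.
  rewrite mulrCA ler_wpM2l // mulrA ler_wpM2r ?(ltW VR0) //.
  by have := leq_trunc_div (m k) a; rewrite -(@ler_nat R) natrM.
rewrite natrM le_eqVlt; apply/orP; left; apply/eqP; field.
by rewrite gt_eqF.
Qed.

Lemma density_le m M : (forall k, 0 < m k)%N -> (forall k, 0 < M k)%N ->
  density m <= density M + ln C%:R * \sum_k ((M k)%:R / (m k)%:R).
Proof.
(* The sides listed in [s] are already those of [M]; each further side costs one term of the error
   sum through [density_step]. *)
move=> m0 M0; pose mix (s : seq 'I_d) k := if k \in s then M k else m k.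
have mix0 s k : (0 < mix s k)%N by rewrite /mix; case: ifP.
suff H s : uniq s ->
    density m <= density (mix s) + ln C%:R * \sum_(k <- s) ((M k)%:R / (m k)%:R).
  have := H _ (enum_uniq 'I_d); rewrite big_enum /=.
  suff -> : mix (enum 'I_d) = M by [].
  by apply/funext => k; rewrite /mix mem_enum.
elim: s => [|k s IH] /=; first by rewrite big_nil mulr0 addr0.
move=> /andP[ks /IH {}IH]; apply: le_trans IH _.
rewrite big_cons mulrDr addrA lerD2r.
have mk : mix s k = m k by rewrite /mix (negbTE ks).
have := density_step k (mix0 s) (M0 k); rewrite mk.
suff -> : update (mix s) k (M k) = mix (k :: s) by [].
by apply/funext => l; rewrite /update /mix in_cons; case: eqVneq => [->|].
Qed.

(** As in Fekete's lemma, the limit is the infimum of the densities: [density_le] compares a large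
    [m] with a nearly optimal fixed [M]. *)
Lemma density_cvg : exists h : R, (density @ @size_infty d --> h)%classic.
Proof.
pose E : set R := [set density m | m in [set m | forall k, (0 < m k)%N]]%classic.
have E0 : lbound E 0 by move=> _ [m m0 <-]; exact: density_ge0.
have hE : has_inf E.
  by split; [exists (density (fun=> 1%N)), (fun=> 1%N) | exists 0].
exists (inf E); apply/cvgrPdist_lt => eps eps0.
have [_ [M M0 <-] hM] := inf_adherent (divr_gt0 eps0 (ltr0n R 2)) hE.
have C0 : 0 <= ln C%:R :> R by rewrite ln_ge0 // ler1n.
pose S : R := ln C%:R * \sum_k (M k)%:R.
have S0 : 0 <= S by rewrite mulr_ge0 // sumr_ge0.
(* Chosen so that the error [S / N] is below [eps / 2]; the other half of [eps] is spent on the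
   choice of [M]. *)
pose N := (Num.truncn (S / (eps / 2))).+1.
exists N => // m Nm /=.
have m0 k : (0 < m k)%N by apply: leq_trans (Nm k).
have le1 : inf E <= density m.
  by apply: ge_inf; [exists 0 | exists m].
rewrite ltr_distlC; apply/andP; split; first by lra.
have := density_le m0 M0.
have : ln C%:R * (\sum_k ((M k)%:R / (m k)%:R)) <= S / N%:R.
  rewrite /S -mulrA ler_wpM2l // mulr_suml; apply: ler_sum => k _.
  by rewrite ler_wpM2l // lef_pV2 ?posrE ?ltr0n // ler_nat.
have : S / N%:R < eps / 2.
  rewrite ltr_pdivrMr ?ltr0n // mulrC -ltr_pdivrMr ?divr_gt0 //.
  exact: truncnS_gt.
lra.
Qed.

End Fekete.

Lemma growth_dichotomy (R : realType) d (f : ('I_d -> nat) -> nat) C :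
  (0 < C)%N -> (forall m, f m <= C ^ vol m)%N ->
  (forall m k a b,
    f (update m k (a + b)) <= f (update m k a) * f (update m k b))%N ->
  (\forall m \near @size_infty d, f m = 0%N) \/
  (forall m, (forall k, 0 < m k)%N -> (0 < f m)%N) /\
  exists h : R, (density R f @ @size_infty d --> h)%classic.
Proof.
move=> C0 fC fs.
have [f0|] := pselect (forall m, (forall k, 0 < m k)%N -> (0 < f m)%N).
  by right; split=> //; exact: density_cvg C0 fC fs f0.
move=> /existsNP[M /not_implyP[M0 /negP]]; rewrite -eqn0Ngt => /eqP fM; left.
exists (\max_k M k)%N => // m /= Mm; apply: (submul_eq0_above C0 fC fs M0 fM) => k.
by apply: leq_trans (Mm k); exact: leq_bigmax.
Qed.

(** * Growth rates in the extended reals *)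

Section GrowthRate.
Variables (R : realType) (d : nat) (f : ('I_d -> nat) -> nat).

Definition growth_rate : \bar R :=
  lim ((fun m => lne ((f m)%:R%:E) / (vol m)%:R%:E)%E @ @size_infty d)%classic.

Lemma near_sizes (N : nat) : \forall m \near @size_infty d, forall k, (N <= m k)%N.
Proof. by exists N. Qed.

Lemma growth_rate_eq0 :
  (\forall m \near @size_infty d, f m = 0%N) -> growth_rate = -oo%E.
Proof.
move=> f0; apply: cvg_lim => //; apply: cvg_near_cst; near=> m.
have -> : f m = 0%N by near: m.
have v0 : (0 < vol m)%N by apply: vol_gt0; near: m; exact: near_sizes.
rewrite /= lexx inver ifF ?gt_eqF ?ltr0n // gt0_mulNye // lte_fin invr_gt0 ltr0n //.
Unshelve. all: by end_near. Qed.

Lemma growth_rate_cvg h :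
  (forall m, (forall k, 0 < m k)%N -> (0 < f m)%N) ->
  (density R f @ @size_infty d --> h)%classic -> growth_rate = h%:E.
Proof.
move=> f0 fh; apply: cvg_lim => //.
have : ((fun m => (density R f m)%:E) @ @size_infty d --> h%:E)%classic.
  exact: cvg_comp fh _.
apply: cvg_trans; apply: near_eq_cvg; near=> m.
have m0 : forall k, (0 < m k)%N by near: m; exact: near_sizes.
rewrite lne_EFin ?ltr0n ?f0 // inver ifF ?gt_eqF ?ltr0n ?vol_gt0 //.
Unshelve. all: by end_near. Qed.

End GrowthRate.

(** * The entropy inequalities *)

(** This replaces dividing by [k] and letting [k] tend to infinity. Arbitrarily large [k] suffice,
    so it also applies along the powers of 2. *)
Lemma linear_bounded_le0 (R : realType) (x c : R) :
  (forall N : nat, exists2 k : nat, (N <= k)%N & k%:R * x <= c) -> x <= 0.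
Proof.
move=> h; rewrite leNgt; apply/negP => x0.
have [k Nk] := h (Num.truncn (c / x)).+1.
rewrite leNgt => /negP; apply; rewrite -ltr_pdivrMr //.
by apply: lt_le_trans (truncnS_gt _) _; rewrite ler_nat.
Qed.

Lemma cons_size_ge d (N K : nat) (m : 'I_d -> nat) :
  (N <= K)%N -> (forall k, N <= m k)%N -> forall k, (N <= cons_size K m k)%N.
Proof. by move=> NK Nm k; rewrite /cons_size; case: unliftP. Qed.

Section EntropyBounds.
Variables (R : realType) (d n : nat) (Gam : 'I_d.+1 -> rel 'I_n).
Hypotheses (n_gt0 : (0 < n)%N) (hsym : symmetric (Gam ord0)).

Let w (m : 'I_d.+1 -> nat) := #|W Gam m|.
Let c l (m : 'I_d -> nat) := card_Wper Gam l m.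

(** Changes the normalization from the full volume to that of the box [m], the one used by the
    periodic counts. *)
Lemma density_cons_size K m : (0 < K)%N ->
  density R w (cons_size K m) * K%:R = ln (w (cons_size K m))%:R / (vol m)%:R.
Proof.
move=> K0; rewrite /density vol_cons_size natrM invfM mulrA mulrAC divfK //.
by rewrite pnatr_eq0 -lt0n.
Qed.

Lemma W_dichotomy :
  (\forall m \near @size_infty d.+1, w m = 0%N) \/
  (forall m, (forall k, 0 < m k)%N -> (0 < w m)%N) /\
  exists h : R, (density R w @ @size_infty d.+1 --> h)%classic.
Proof.
by apply: (growth_dichotomy R n_gt0) => *; [exact: card_W_le|exact: card_W_submul].
Qed.

Lemma Wper_dichotomy l :
  (\forall m \near @size_infty d, c l m = 0%N) \/
  (forall m, (forall k, 0 < m k)%N -> (0 < c l m)%N) /\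
  exists h : R, (density R (c l) @ @size_infty d --> h)%classic.
Proof.
apply: (@growth_dichotomy R d _ (n ^ l.+1)); first by rewrite expn_gt0 n_gt0.
  by move=> m; exact: card_Wper_le.
by move=> *; exact: card_Wper_submul.
Qed.

Lemma W_le_density r k m : (0 < k)%N -> (forall l, 0 < m l)%N ->
  (0 < w (cons_size (2 * r * k).+1 m))%N ->
  density R w (cons_size (2 * r * k).+1 m) * (2 * r * k).+1%:R <=
  density R (c 0) m + k%:R * density R (c (2 * r)) m.
Proof.
move=> k0 m0 w0; have wc := card_W_le_Wper m hsym r k0.
have := leq_trans w0 wc; rewrite muln_gt0 expn_gt0 gtn_eqF // orbF.
move=> /andP[c0 cr].
rewrite density_cons_size // {}/density mulrA -mulrDl ler_wpM2r ?invr_ge0 //.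
rewrite mulr_natl -lnXn ?ltr0n // -lnM ?posrE ?exprn_gt0 ?ltr0n //.
rewrite ler_ln ?posrE ?mulr_gt0 ?exprn_gt0 ?ltr0n //.
by rewrite -natrX -natrM ler_nat.
Qed.

Lemma density_Wper_le p q j m : (forall l, 0 < m l)%N ->
  (0 < c (p + 2 * q) m)%N ->
  (2 ^ j)%:R * density R (c (p + 2 * q)) m <=
  (2 ^ j - 1)%:R * density R (c (2 * q)) m +
  density R w (cons_size (2 * q + 2 ^ j * p).+1 m)
    * (2 * q + 2 ^ j * p).+1%:R.
Proof.
move=> m0 cp; have cw := card_Wper_growth m hsym p q j.
have cq : (0 < c (2 * q) m)%N.
  rewrite lt0n; apply: contraTneq cp => cq.
  by rewrite /c (card_Wper_eq0 hsym p cq) ltnn.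
have : (0 < c (p + 2 * q) m ^ 2 ^ j)%N by rewrite expn_gt0 cp.
move=> /leq_trans/(_ cw); rewrite muln_gt0 => /andP[_ w0].
rewrite density_cons_size // {}/density !mulrA -mulrDl ler_wpM2r ?invr_ge0 //.
rewrite !mulr_natl -!lnXn ?ltr0n // -lnM ?posrE ?exprn_gt0 ?ltr0n //.
rewrite ler_ln ?posrE ?mulr_gt0 ?exprn_gt0 ?ltr0n //.
by rewrite -!natrX -natrM ler_nat.
Qed.

Lemma entropyE : entropy R Gam = growth_rate R w.
Proof. by []. Qed.

Lemma per_entropyE l : per_entropy R Gam l = growth_rate R (c l).
Proof. by []. Qed.

Lemma entropy_le_per_entropy r : (0 < r)%N ->
  (entropy R Gam <= per_entropy R Gam (2 * r) / (2 * r)%:R%:E)%E.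
Proof.
move=> r0; rewrite entropyE per_entropyE.
have r20 : (0 < 2 * r)%N by rewrite muln_gt0.
case: W_dichotomy => [w0|[w0 [h wh]]]; first by rewrite growth_rate_eq0 ?leNye.
(* Positivity of both periodic counts is read off from [card_W_le_Wper] with [k = 1]. *)
have c0 l m : (l = 0%N \/ l = (2 * r)%N) -> (forall k, 0 < m k)%N -> (0 < c l m)%N.
  move=> lE m0; have := card_W_le_Wper m hsym r (ltn0Sn 0).
  have := w0 (cons_size (2 * r * 1).+1 m) (cons_size_ge (ltn0Sn _) m0).
  move=> /leq_trans/[apply]; rewrite expn1 muln_gt0 => /andP[].
  by case: lE => ->.
have c_cvg l : (l = 0%N \/ l = (2 * r)%N) ->
    exists a : R, (density R (c l) @ @size_infty d --> a)%classic.
  move=> lE; case: (Wper_dichotomy l) => [[N _ cN]|[]//].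
  have := @c0 l (fun=> N.+1) lE (fun=> ltn0Sn N).
  by rewrite cN //= => _ /=; rewrite leqnSn.
have [a0 h0] := c_cvg 0%N (or_introl erefl).
have [a ha] := c_cvg (2 * r)%N (or_intror erefl).
rewrite (growth_rate_cvg w0 wh) (growth_rate_cvg (c0 _ ^~ (or_intror erefl)) ha).
rewrite inver ifF; last by rewrite pnatr_eq0 gtn_eqF.
rewrite -EFinM lee_fin; apply/ler_addgt0Pr => e e0.
rewrite -lerBlDr ler_pdivlMr ?ltr0n //.
(* The threshold [N] depends only on [e] and bounds all sides at once. Hence [k] can be fixed above
   [N] while the other sides tend to infinity, and no iterated limit is needed. *)
have /cvgrPdist_lt/(_ _ e0)[N _ hN] := wh.
(* In the constant, [a0] comes from the factor [card_Wper Gam 0 m] and [h - e] from the one extra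
   column in [2 * r * k + 1]. *)
rewrite -subr_le0; apply: (@linear_bounded_le0 _ _ (a0 - (h - e))) => M.
exists (maxn M N.+1); first exact: leq_maxl.
set k := maxn M N.+1.
have Nk : (N < k)%N by exact: leq_maxr.
have k0 : (0 < k)%N by exact: leq_trans Nk.
have : (h - e) * (2 * r * k).+1%:R <= a0 + k%:R * a.
  apply: (cvgr_to_ge (F := @size_infty d)
    (f := fun m => density R (c 0) m + k%:R * density R (c (2 * r)) m)).
    exact: (cvgD h0 (cvgMl_tmp ha)).
  near=> m.
  have m0 : forall l, (0 < m l)%N by near: m; exact: near_sizes.
  apply: le_trans _ (W_le_density k0 m0 _); last first.
    by apply: w0; exact: cons_size_ge.
  rewrite ler_wpM2r //.
  have := hN (cons_size (2 * r * k).+1 m); rewrite /= ltr_distlC => H.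
  have /H/andP[/ltW + _] : forall l, (N <= cons_size (2 * r * k).+1 m l)%N.
    apply: cons_size_ge; last by near: m; exact: near_sizes.
    by rewrite ltnW // ltnS (leq_trans (ltnW Nk)) // leq_pmull.
  by [].
rewrite -natr1 !natrM.
lra.
Unshelve. all: by end_near. Qed.

Lemma per_entropy_diff_le p q : (0 < p)%N ->
  ((per_entropy R Gam (p + 2 * q) - per_entropy R Gam (2 * q)) / p%:R%:E
   <= entropy R Gam)%E.
Proof.
move=> p0; rewrite entropyE !per_entropyE.
have pV : (p%:R%:E^-1 = (p%:R^-1 : R)%:E)%E.
  by rewrite inver ifF // pnatr_eq0 gtn_eqF.
(* If the count for [p + 2 * q] vanishes eventually, the left side is [-oo] whatever the subtracted
   term is. Otherwise all three rates are finite. *)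
case: (Wper_dichotomy (p + 2 * q)) => [c0|[c0 [a ha]]].
  rewrite (growth_rate_eq0 R c0) addNye pV gt0_mulNye ?leNye //.
  by rewrite lte_fin invr_gt0 ltr0n.
have cq0 m : (forall k, 0 < m k)%N -> (0 < c (2 * q) m)%N.
  move=> m0; rewrite lt0n; apply: contraTneq (c0 m m0) => cq.
  by rewrite /c (card_Wper_eq0 hsym p cq) ltnn.
have [b hb] : exists b : R, (density R (c (2 * q)) @ @size_infty d --> b)%classic.
  case: (Wper_dichotomy (2 * q)) => [[N _ cN]|[]//].
  have := @cq0 (fun=> N.+1) (fun=> ltn0Sn N).
  by rewrite cN //= => _ /=; rewrite leqnSn.
have wj0 j m : (forall k, 0 < m k)%N ->
    (0 < w (cons_size (2 * q + 2 ^ j * p).+1 m))%N.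
  move=> m0; have := card_Wper_growth m hsym p q j.
  have : (0 < c (p + 2 * q) m ^ 2 ^ j)%N by rewrite expn_gt0 c0.
  by move=> /leq_trans/[apply]; rewrite muln_gt0 => /andP[].
have large N j : (N <= 2 ^ j)%N -> (N <= (2 * q + 2 ^ j * p).+1)%N.
  move=> Nj; rewrite ltnW // ltnS (leq_trans Nj) // (leq_trans _ (leq_addl _ _)) //.
  by rewrite leq_pmulr.
(* Eventual vanishing of [w] contradicts [wj0], taken at [j = N] to make the first side large
   enough. *)
case: W_dichotomy => [[N _ w0]|[w0 [h wh]]].
  have := wj0 N (fun=> N.+1) (fun=> ltn0Sn N).
  rewrite /w [X in (0 < X)%N]w0 //; apply: cons_size_ge => //.
  by apply: large; rewrite ltnW // ltn_expl.
rewrite (growth_rate_cvg w0 wh) (growth_rate_cvg c0 ha) (growth_rate_cvg cq0 hb).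
rewrite pV -EFinB -EFinM lee_fin; apply/ler_addgt0Pr => e e0.
rewrite ler_pdivrMr ?ltr0n //.
have /cvgrPdist_lt/(_ _ e0)[N _ hN] := wh.
rewrite -subr_le0.
(* The part of the estimate that does not grow with [2 ^ j]: the [2 * q + 1] surplus columns
   contribute [h + e] each, and the exponent [2 ^ j - 1] leaves [- b]. *)
apply: (@linear_bounded_le0 _ _ ((2 * q).+1%:R * (h + e) - b)) => M.
set j := maxn M N; have Mj : (M <= j)%N by exact: leq_maxl.
have Nj : (N <= 2 ^ j)%N.
  by apply: leq_trans (ltnW (ltn_expl j _)) => //; exact: leq_maxr.
exists (2 ^ j)%N; first by apply: leq_trans Mj (ltnW (ltn_expl j _)).
have : 0 <= (2 ^ j - 1)%:R * b + (h + e) * (2 * q + 2 ^ j * p).+1%:R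
            - (2 ^ j)%:R * a.
  apply: (cvgr_to_ge (F := @size_infty d)
    (f := fun m => (2 ^ j - 1)%:R * density R (c (2 * q)) m
      + (h + e) * (2 * q + 2 ^ j * p).+1%:R
      - (2 ^ j)%:R * density R (c (p + 2 * q)) m)).
    exact: (cvgB (cvgD (cvgMl_tmp hb) (cvg_cst _)) (cvgMl_tmp ha)).
  near=> m.
  have m0 : forall l, (0 < m l)%N by near: m; exact: near_sizes.
  rewrite subr_ge0; apply: le_trans (density_Wper_le j m0 (c0 m m0)) _.
  rewrite lerD2l ler_wpM2r //.
  have := hN (cons_size (2 * q + 2 ^ j * p).+1 m); rewrite /= ltr_distlC => H.
  have /H/andP[_ /ltW] : forall l, (N <= cons_size (2 * q + 2 ^ j * p).+1 m l)%N.
    by apply: cons_size_ge; [exact: large | near: m; exact: near_sizes].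
  by [].
rewrite natrB ?expn_gt0 // -!natr1 natrD [(2 ^ j * p)%:R]natrM.
lra.
Unshelve. all: by end_near. Qed.

End EntropyBounds.

(* The dimension is d.+1.  In \bar R the difference (-oo) - (-oo) is -oo. *)
Theorem theorem3p1 (R : realType) (d n : nat) (hd : (2 <= d.+1)%N)
    (hn : (1 <= n)%N) (Gam : 'I_d.+1 -> rel 'I_n)
    (hsym : symmetric (Gam ord0))
    (p q r : nat) (hp : (1 <= p)%N) (hr : (1 <= r)%N) :
  (per_entropy R Gam (2 * r) / (2 * r)%:R%:E >= entropy R Gam)%E /\
  (entropy R Gam >=
     (per_entropy R Gam (p + 2 * q) - per_entropy R Gam (2 * q)) / p%:R%:E)%E.
Proof.
by split; [exact: entropy_le_per_entropy | exact: per_entropy_diff_le].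
Qed.
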